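(* Let $k$ be an integer, and let $G$ be a graph of order $n$. (1) If $\delta(G)\geq k\geq 0$ and $q(G)\geq q(\underline{N}_n^k)$, where $n\geq\max\{6k+10,(3k^2+9k+8)/2\}$, then $G$ is traceable unless $G=\underline{N}_n^k$. (2) If $\delta(G)\geq k\geq 1$ and $q(G)\geq q(N_n^k)$, where $n\geq\max\{6k+5,(3k^2+5k+4)/2\}$, then $G$ is Hamiltonian unless $G=N_n^k$.
   Context: All graphs are finite and simple; equality of graphs means isomorphism. $\delta(G)$ is the minimum degree of $G$. $q(G)$ is the signless Laplacian spectral radius, i.e. the largest eigenvalue of $Q=A+D$, where $A$ is the adjacency matrix and $D$ the diagonal degree matrix of $G$. A graph is Hamiltonian (traceable) if it contains a cycle (path) through all its vertices. $G_1+G_2$ denotes the disjoint union of graphs, $kG$ the disjoint union of $k$ copies of $G$, and $G_1\vee G_2$ the join (the disjoint union together with all edges between $V(G_1)$ and $V(G_2)$). For $1\leq k\leq (n-1)/2$, $N_n^k=K_k\vee(K_{n-2k}+kK_1)$. For $0\leq k\leq n/2-1$, $\underline{N}_n^k=K_k\vee(K_{n-2k-1}+(k+1)K_1)$ (for $k=0$ this is $K_{n-1}+K_1$). *)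

(* Defs.v *)
From mathcomp Require Import all_boot all_order all_algebra.
From mathcomp Require Import classical_sets reals.

Set Implicit Arguments.
Unset Strict Implicit.
Unset Printing Implicit Defensive.

Import GRing.Theory Num.Theory.

Record sgraph := SGraph {
  vertex :> finType;
  adj : rel vertex;
  adj_sym : symmetric adj;
  adj_irrefl : irreflexive adj
}.

Definition isomorphic (G H : sgraph) : Prop :=
  exists2 f : G -> H, bijective f & {mono f : x y / adj x y}.

Section Constructions.
Variables G H : sgraph.

Definition dunion_rel : rel (G + H) := fun u v =>
  match u, v with
  | inl x, inl y => adj x y
  | inr x, inr y => adj x y
  | _, _ => false
  end.

Fact dunion_sym : symmetric dunion_rel.
Proof. by move=> [x|x] [y|y] //=; apply: adj_sym. Qed.
Fact dunion_irrefl : irreflexive dunion_rel.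
Proof. by move=> [x|x] /=; apply: adj_irrefl. Qed.

Definition dunion : sgraph := SGraph dunion_sym dunion_irrefl.

Definition join_rel : rel (G + H) := fun u v =>
  match u, v with
  | inl x, inl y => adj x y
  | inr x, inr y => adj x y
  | _, _ => true
  end.

Fact join_sym : symmetric join_rel.
Proof. by move=> [x|x] [y|y] //=; apply: adj_sym. Qed.
Fact join_irrefl : irreflexive join_rel.
Proof. by move=> [x|x] /=; apply: adj_irrefl. Qed.

Definition join : sgraph := SGraph join_sym join_irrefl.

Variable k : nat.

Definition copies_rel : rel ('I_k * G) := fun u v =>
  (u.1 == v.1) && adj u.2 v.2.

Fact copies_sym : symmetric copies_rel.
Proof. by move=> u v; rewrite /copies_rel eq_sym adj_sym. Qed.
Fact copies_irrefl : irreflexive copies_rel.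
Proof. by move=> u; rewrite /copies_rel adj_irrefl andbF. Qed.

Definition copies : sgraph := SGraph copies_sym copies_irrefl.

End Constructions.

Definition complete_rel (n : nat) : rel 'I_n := fun i j => i != j.

Fact complete_sym n : symmetric (@complete_rel n).
Proof. by move=> i j; rewrite /complete_rel eq_sym. Qed.
Fact complete_irrefl n : irreflexive (@complete_rel n).
Proof. by move=> i; rewrite /complete_rel eqxx. Qed.

Definition complete (n : nat) : sgraph :=
  SGraph (@complete_sym n) (@complete_irrefl n).

(* Truncated subtraction: N_graph is meant for 2 * k < n, and N_under_graph
   for 2 * k.+1 <= n; in these ranges both have order n. *)
Definition N_graph (n k : nat) : sgraph :=
  join (complete k) (dunion (complete (n - 2 * k)) (copies (complete 1) k)).

Definition N_under_graph (n k : nat) : sgraph :=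
  join (complete k)
    (dunion (complete (n - 2 * k - 1)) (copies (complete 1) k.+1)).

Definition degree (G : sgraph) (x : G) : nat := #|[set y | adj x y]|.

(* Every degree is smaller than #|G|, so the default value #|G| does not affect
   the minimum as soon as G has a vertex. *)
Definition min_degree (G : sgraph) : nat := \big[minn/#|G|]_(x : G) degree x.

(* A cycle of a simple graph has at least three vertices. *)
Definition hamiltonian (G : sgraph) : Prop :=
  exists c : seq G,
    [/\ (2 < size c)%N, cycle (@adj G) c, uniq c & forall x, x \in c].

Definition traceable (G : sgraph) : Prop :=
  exists (x : G) (p : seq G),
    [/\ path (@adj G) x p, uniq (x :: p) & forall y, y \in x :: p].

Local Open Scope ring_scope.

Definition adj_mx (R : pzRingType) (G : sgraph) : 'M[R]_#|G| :=
  \matrix_(i, j) (adj (enum_val i) (enum_val j))%:R.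

Definition deg_mx (R : pzRingType) (G : sgraph) : 'M[R]_#|G| :=
  diag_mx (\row_i (degree (enum_val i))%:R).

Definition signless_laplacian (R : pzRingType) (G : sgraph) : 'M[R]_#|G| :=
  adj_mx R G + deg_mx R G.

(* The largest eigenvalue: a real symmetric matrix of positive size has a
   nonempty finite set of real eigenvalues, so the supremum is a maximum. *)
Definition q_radius (R : realType) (G : sgraph) : R :=
  sup [set a : R | eigenvalue (signless_laplacian R G) a]%classic.

(* Main.v *)
(* Merris' bound, with Das' estimate, gives [q <= 2e/(n-1) + n - 2], so the
   hypothesis on [q(G)] makes [G] dense. If [G] is not Hamiltonian, enlarge it to
   an edge-maximal non-Hamiltonian graph: by Ore, nonadjacent vertices have degree
   sum less than [n], and the number of edges forces a set [A] of exactly [k]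
   vertices of degree [k], a clique on the other vertices, and a set [X] of
   [s <= k] vertices of the clique completely joined to [A]. All these graphs are
   compared with [N] at once: a positive eigenvector of the quotient matrix for
   [s] is a Collatz-Wielandt supersolution for the largest eigenvalue of [N],
   strict if [s < k], and for [s = k] tightness propagates along edges and forces
   [G = N]. Traceability of [G] is Hamiltonicity of [G v K_1], which replaces
   [(n, k)] by [(n+1, k+1)] in the combinatorial part. *)
Require Import Defs.
From mathcomp Require Import classical_sets boolp reals.
From mathcomp Require Import all_boot all_order all_algebra.
From mathcomp Require Import polyrcf zify ring lra.

Set Implicit Arguments.
Unset Strict Implicit.
Unset Printing Implicit Defensive.

Import Order.TTheory GRing.Theory Num.Theory.

(** * Ore's closure *)

(** Degrees and Hamilton cycles belong to a relation on a fixed type, so that edges can be added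
    without changing the vertices. *)
Definition deg (T : finType) (e : rel T) (x : T) : nat := #|[set y | e x y]|.

Definition ham (T : finType) (e : rel T) : Prop :=
  exists c : seq T,
    [/\ (2 < size c)%N, cycle e c, uniq c & forall x, x \in c].

Definition add_edge (T : eqType) (e : rel T) (u v : T) : rel T :=
  fun x y => [|| e x y, (x == u) && (y == v) | (x == v) && (y == u)].

Lemma add_edge_sym (T : eqType) (e : rel T) u v :
  symmetric e -> symmetric (add_edge e u v).
Proof.
move=> es x y; rewrite /add_edge es; congr orb.
by rewrite orbC ![(y == _) && _]andbC.
Qed.

Lemma add_edge_irrefl (T : eqType) (e : rel T) u v :
  irreflexive e -> u != v -> irreflexive (add_edge e u v).
Proof.
move=> ei uv x; rewrite /add_edge ei /= andbC orbb.
by apply/negP => /andP[/eqP-> /eqP E]; rewrite E eqxx in uv.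
Qed.

(* Ore's crossing argument: if [y ~ next w] and [x ~ w], the Hamilton path from
   [y] to [x] is closed up by replacing the edge from [w] to [next w]. *)
Lemma ham_path_close (T : finType) (e : rel T) (y : T) (p : seq T) :
  symmetric e -> irreflexive e ->
  path e y p -> uniq (y :: p) -> (forall z, z \in y :: p) -> (1 < size p)%N ->
  (#|T| <= deg e y + deg e (last y p))%N -> ham e.
Proof.
move=> es ei pyp un cov szp degs.
set x := last y p in degs *.
have szc : size (y :: p) = (size p).+1 by [].
have xE : x = nth y (y :: p) (size p) by rewrite nth_last.
have nx : next (y :: p) x = y.
  rewrite next_nth cov xE index_uniq //; exact: nth_default.
(* [S] and [N] both miss [x], and their sizes add up to at least [#|T|], so they share a vertex. *)
pose S := [set w | e y (next (y :: p) w)].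
pose N := [set w | e x w].
have cS : #|S| = deg e y.
  rewrite /deg -(card_preimset [set w | e y w] (can_inj (prev_next un))).
  by apply: eq_card => w; rewrite !inE.
have sub : S :|: N \subset [set~ x].
  apply/subsetP => w; rewrite !inE; apply: contraTneq => ->.
  by rewrite nx !ei.
have : (0 < #|S :&: N|)%N.
  have := cardsUI S N; have := subset_leq_card sub.
  have := cardsC1 x; have : #|N| = deg e x by [].
  have : (0 < #|T|)%N by apply/card_gt0P; exists x.
  lia.
case/card_gt0P => w; rewrite !inE => /andP[yw xw].
have wx : w != x by apply: contraTneq xw => ->; rewrite ei.
have [p1 [w2 [p2 [Ep lp1 yw2]]]] :
    exists p1 w2 p2, [/\ p = p1 ++ w2 :: p2, last y p1 = w & e y w2].
  pose i := index w (y :: p).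
  have ip : (i < size p)%N.
    rewrite ltn_neqAle -ltnS -[(size p).+1]/(size (y :: p)) index_mem cov andbT.
    by apply: contra wx => /eqP Ei; rewrite xE -Ei nth_index.
  exists (take i p), (nth y p i), (drop i.+1 p); split.
  - by rewrite -drop_nth // cat_take_drop.
  - rewrite -nth_last size_takel 1?ltnW //.
    rewrite -[RHS](nth_index y (cov w)) -/i.
    case: i ip => [|i] ip //=.
      by rewrite take0.
    by rewrite nth_take // (set_nth_default y) // ltnW.
  - by move: yw; rewrite next_nth cov.
have lp2 : last w2 p2 = x by rewrite /x Ep last_cat.
exists (y :: p1 ++ rev (w2 :: p2)); split.
- by move: szp; rewrite Ep /= !size_cat size_rev /=; lia.
- rewrite /= rcons_cat cat_path lp1; move: pyp; rewrite Ep cat_path lp1 /=.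
  case/and3P => -> _ pw /=; rewrite -rev_cons.
  have := rev_path e y (rcons (w2 :: p2) w).
  rewrite last_rcons belast_rcons => ->.
  rewrite rcons_cons /= rcons_path es yw2 /= lp2 es xw andbT.
  by rewrite (eq_path (e' := e)) // => a b; rewrite es.
- have /perm_uniq-> // : perm_eq (y :: p1 ++ rev (w2 :: p2)) (y :: p).
  by rewrite Ep perm_cons perm_cat2l perm_rev.
- move=> z; have /perm_mem-> // : perm_eq (y :: p1 ++ rev (w2 :: p2)) (y :: p).
  by rewrite Ep perm_cons perm_cat2l perm_rev.
Qed.

(** A Hamilton cycle through the new edge, cut there, is a Hamilton path of [e] with ends [u] and
    [v], and [ham_path_close] applies. *)
Lemma ham_add_edge (T : finType) (e : rel T) (u v : T) :
  symmetric e -> irreflexive e -> (#|T| <= deg e u + deg e v)%N ->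
  ham (add_edge e u v) -> ham e.
Proof.
move=> es ei degs [c [szc cc uc cov]].
have [ce|nce] := boolP (cycle e c); first by exists c.
have [x xc nex] : exists2 x, x \in c & ~~ e x (next c x).
  apply/hasP; apply: contraR nce => /hasPn H.
  by apply: (cycle_from_next uc) => z /H; rewrite negbK.
set y := next c x in nex.
have yx : add_edge e x y =2 add_edge e u v.
  have := next_cycle cc xc; rewrite -/y /add_edge (negbTE nex) /=.
  case/orP => /andP[/eqP Ex /eqP Ey] a b; rewrite Ex Ey //.
  by congr orb; rewrite orbC.
have degs' : (#|T| <= deg e y + deg e x)%N.
  have := next_cycle cc xc; rewrite -/y /add_edge (negbTE nex) /=.
  by case/orP => /andP[/eqP-> /eqP->]; rewrite // addnC.
case: (rot_to (cov y)) => i p Ep.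
have up : uniq (y :: p) by rewrite -Ep rot_uniq.
have lx : last y p = x.
  have : prev (y :: p) y = x by rewrite -Ep prev_rot // /y prev_next.
  rewrite prev_nth mem_head memNindex ?nth_last //; by case/andP: up.
have szp : (1 < size p)%N by move: szc; rewrite -(size_rot i) Ep.
have pa : path (add_edge e x y) y p.
  rewrite (eq_path yx); move: cc; rewrite -(rot_cycle i) Ep /= rcons_path.
  by case/andP.
apply: (@ham_path_close _ _ y p) => //; last by rewrite lx.
(* The new edge joins the ends [y] and [x] and is no step of the path: the first step does not reach
   [x], as [p] has at least two vertices, and the later steps avoid [y]. *)
- case: p {Ep} up lx szp pa => [|b [|b' p]] //= /and3P[yp bp up] lx _.
  have bx : b != x.
    by apply: contraNneq bp => ->; rewrite -lx mem_last.
  have byy : b != y by apply: contraNneq yp => ->; rewrite mem_head.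
  case/andP; rewrite {1}/add_edge (negbTE bx) (negbTE byy) !andbF !orbF => -> /=.
  apply: (@sub_in_path _ (predC1 y) (add_edge e x y) e _ b (b' :: p)).
    move=> a1 a2; rewrite !inE => /negbTE ay1 /negbTE ay2.
    by rewrite /add_edge ay1 ay2 andbF !orbF.
  by apply/allP => z zz /=; apply: contraNneq yp => <-.
- by move=> z; rewrite -Ep mem_rot.
Qed.

Definition ore_closed (T : finType) (e : rel T) :=
  forall u v, u != v -> ~~ e u v -> (deg e u + deg e v < #|T|)%N.

(** This is the Bondy-Chvatal closure; the induction is on the number of nonadjacent pairs, which
    each added edge lowers. *)
Lemma ore_closure (T : finType) (e : rel T) :
  symmetric e -> irreflexive e -> ~ ham e ->
  exists e' : rel T, [/\ symmetric e', irreflexive e', subrel e e', ~ ham e' &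
                         ore_closed e'].
Proof.
have [N] := ubnP #|[set p : T * T | ~~ e p.1 p.2]|.
elim: N e => // N IH e ltN es ei nh.
have [|nc] := boolP [forall u, forall v,
    (u != v) ==> ~~ e u v ==> (deg e u + deg e v < #|T|)%N].
  move=> /forallP H; exists e; split => // u v uv nuv.
  by have /forallP/(_ v)/implyP/(_ uv)/implyP/(_ nuv) := H u.
move: nc; rewrite negb_forall => /existsP[u]; rewrite negb_forall.
case/existsP => v; rewrite !negb_imply -leqNgt => /and3P[uv nuv degs].
have [||||e' [? ? sub ? ?]] := IH (add_edge e u v).
- apply: leq_trans (ltN : (_ <= N)%N); apply: proper_card; apply/properP; split.
    apply/fintype.subsetP => -[a b]; rewrite !inE /add_edge /=.
    by apply: contra => ->.
  by exists (u, v); rewrite !inE //= /add_edge !eqxx orbT.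
- exact: add_edge_sym.
- exact: add_edge_irrefl.
- by move=> /(ham_add_edge es ei degs).
exists e'; split => // a b ab; apply: sub; by rewrite /add_edge ab.
Qed.

(** * The structure of dense non-Hamiltonian graphs *)

Lemma leq_deg (T : finType) (e e' : rel T) x :
  subrel e e' -> (deg e x <= deg e' x)%N.
Proof.
by move=> sub; apply/subset_leq_card/fintype.subsetP => y; rewrite !inE; apply: sub.
Qed.

Lemma degE (T : finType) (e : rel T) x : deg e x = (\sum_y e x y)%N.
Proof.
rewrite /deg -sum1_card big_mkcond; apply: eq_bigr => y _.
by rewrite inE; case: (e x y).
Qed.

(** Edges between [A] and its complement are charged twice to degrees in [A]; the other vertices
    span at most a clique. *)
Lemma sum_deg_leq (T : finType) (e : rel T) (A : {set T}) :
  symmetric e -> irreflexive e ->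
  (\sum_v deg e v <=
   2 * \sum_(v in A) deg e v + (#|T| - #|A|) * (#|T| - #|A| - 1))%N.
Proof.
move=> es ei.
have cA : #|~: A| = (#|T| - #|A|)%N by have := cardsC A; lia.
rewrite (bigID (mem A)) /= mul2n -addnn -addnA leq_add2l.
have -> : (\sum_(v | v \notin A) deg e v =
   \sum_(v | v \notin A) \sum_(w in A) e v w +
   \sum_(v | v \notin A) \sum_(w | w \notin A) e v w)%N.
  rewrite -big_split /=; apply: eq_bigr => v _.
  by rewrite degE (bigID (mem A)).
apply: leq_add.
  rewrite exchange_big /=; apply: leq_sum => w _; rewrite degE.
  rewrite [leqRHS](bigID (mem A)) /=; apply: leq_trans (leq_addl _ _).
  by apply: leq_sum => v _; rewrite es.
rewrite -cA -sum_nat_const.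
rewrite (eq_bigl (mem (~: A))) => [|v]; last by rewrite /= inE.
apply: leq_sum => v; rewrite [_ v]in_setC => vA.
rewrite (bigD1 v) //= ei add0n.
have -> : (#|~: A| - 1 = \sum_(w | (w \notin A) && (w != v)) 1)%N.
  rewrite -sum1_card (eq_bigl (fun w => w \notin A)) => [|w]; last by rewrite in_setC.
  by rewrite (bigD1 v) //= addKn.
by apply: leq_sum => w _; case: (e v w).
Qed.

Lemma complete_ham (T : finType) (e : rel T) :
  (2 < #|T|)%N -> (forall u v, u != v -> e u v) -> ham e.
Proof.
move=> T2 H; exists (enum T); split; rewrite -?cardE ?enum_uniq //; last first.
  by move=> x; rewrite mem_enum.
apply: cycle_from_next; first exact: enum_uniq.
move=> x _; apply: H; apply/eqP => E.
have : size (enum T) = #|T| by rewrite cardE.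
have := enum_uniq T; have := mem_enum T x; rewrite inE.
move=> /rot_to[i p Ep] un sz.
have := next_rot i un x; rewrite -E Ep next_nth mem_head /= eqxx.
have : uniq (x :: p) by rewrite -Ep rot_uniq.
have : size (x :: p) = #|T| by rewrite -Ep size_rot.
case: p {Ep} => [|b p] /= Esz; first by rewrite -Esz in T2.
by case/andP=> xp _ Eb; rewrite Eb mem_head in xp.
Qed.

(* Take a nonadjacent pair of maximal degree sum: each of the at least [j]
   non-neighbours of its second vertex has degree at most [j]. *)
Lemma ore_closed_low_degrees (T : finType) (e : rel T) :
  symmetric e -> irreflexive e -> (2 < #|T|)%N -> ~ ham e -> ore_closed e ->
  exists2 u, (2 * deg e u < #|T|)%N &
    (deg e u <= #|[set x | deg e x <= deg e u]|)%N.
Proof.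
move=> es ei T2 nh oc.
pose P (p : T * T) := (p.1 != p.2) && ~~ e p.1 p.2.
have [p0 Pp0] : exists p, P p.
  apply: contrapT => nP; apply/nh/complete_ham => // u v uv.
  by apply: contrapT => /negP nuv; apply: nP; exists (u, v); rewrite /P /= uv.
case: (arg_maxnP (fun p : T * T => deg e p.1 + deg e p.2)%N Pp0) => -[u v] /=.
have wlg u' v' : P (u', v') -> (deg e u' <= deg e v')%N ->
    (forall p, P p -> deg e p.1 + deg e p.2 <= deg e u' + deg e v')%N ->
    exists2 u, (2 * deg e u < #|T|)%N &
      (deg e u <= #|[set x | deg e x <= deg e u]|)%N.
  move=> /andP[/= uv nuv] duv M. have := oc _ _ uv nuv; set n := #|T| => d; exists u'; first lia.
  have sub : ~: (v' |: [set y | e v' y]) \subset [set x | deg e x <= deg e u']%N.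
    apply/fintype.subsetP => w; rewrite !inE negb_or => /andP[wv nvw].
    have /= := M (w, v'); rewrite /P /= wv es nvw => /(_ isT). lia.
  have := subset_leq_card sub; have := cardsC (v' |: [set y | e v' y]).
  move: d; rewrite /n; set n' := #|T|.
  rewrite cardsU1 inE ei /= -/(deg e v'). lia.
move=> Puv M; have [duv|/ltnW duv] := leqP (deg e u) (deg e v).
  by apply: (wlg u v).
apply: (wlg v u) => //; last by move=> p /M; rewrite [(deg e v + _)%N]addnC.
by case/andP: Puv => /= uv nuv; rewrite /P /= eq_sym uv es.
Qed.

(* [A] will be the set of low-degree vertices of the closure and [X] the set of
   their neighbours outside [A]. The case [#|X| = k] means that the graph is a
   spanning subgraph of [K_k v (K_m + c K_1)]. *)
Definition low_pair (T : finType) (e : rel T) (c k : nat) (A X : {set T}) :=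
  [/\ [disjoint A & X], #|A| = c, (#|X| <= k)%N,
      (forall a v, a \in A -> e a v -> v \in A :|: X) &
      (forall a, a \in A -> #|[set v in A | e a v]| <= k - #|X|)%N].

(** The assumed bound on the degree sum is what [sum_deg_leq] allows for [k + 1] vertices of degree
    [k + 1], so the low-degree set of the closure has size exactly [k]. *)
Lemma nonham_low_pair (T : finType) (e : rel T) (k : nat) :
  symmetric e -> irreflexive e -> ~ ham e -> (0 < k)%N ->
  (6 * k + 5 <= #|T|)%N -> (forall x, k <= deg e x)%N ->
  ((#|T| - k - 1) * (#|T| - k - 2) + 2 * (k + 1) ^ 2 < \sum_x deg e x)%N ->
  exists A X : {set T}, low_pair e k k A X /\ (0 < #|X|)%N.
Proof.
move=> es0 ei0 nh0 k0 nk dk0 se0.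
have [e' [es ei sub nh oc]] := ore_closure es0 ei0 nh0.
have dk x : (k <= deg e' x)%N by apply: leq_trans (dk0 x) (leq_deg x sub).
have se : ((#|T| - k - 1) * (#|T| - k - 2) + 2 * (k + 1) ^ 2
           < \sum_x deg e' x)%N.
  by apply: leq_trans se0 _; apply: leq_sum => x _; apply: leq_deg.
have T2 : (2 < #|T|)%N by lia.
have [u du ju] := ore_closed_low_degrees es ei T2 nh oc.
have [A Asub cA] : exists2 A : {set T}, A \subset [set x | deg e' x <= deg e' u]%N
    & #|A| = deg e' u.
  have [s [us sz ss]] : exists s : seq T, [/\ uniq s, size s = deg e' u &
      {subset s <= [set x | deg e' x <= deg e' u]%N}].
    exists (take (deg e' u) (enum [set x | deg e' x <= deg e' u]%N)); split.
    - by rewrite take_uniq ?enum_uniq.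
    - by rewrite size_takel // -cardE.
    - by move=> x /mem_take; rewrite mem_enum.
  exists [set x in s]; first by apply/fintype.subsetP => x; rewrite inE; apply: ss.
  by rewrite cardsE; have /card_uniqP-> := us.
have dA a : a \in A -> (deg e' a <= #|A|)%N.
  by move=> aA; have := fintype.subsetP Asub _ aA; rewrite inE cA.
have sA : (\sum_(v in A) deg e' v <= #|A| * #|A|)%N.
  by rewrite -sum_nat_const; apply: leq_sum => a /dA.
have cAk : #|A| = k.
  have := sum_deg_leq A es ei; have := dk u; rewrite -cA in du *.
  move: se sA du; set n := #|T|; set j := #|A|; move=> se sA du kj.
  case: (ltngtP k j) kj => // kj _ S.
  have : (2 * (j * j) + (n - j) * (n - j - 1) <=
          (n - k - 1) * (n - k - 2) + 2 * (k + 1) ^ 2)%N; last lia.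
  move: nk du; rewrite -/n -/j => nk du.
  have [i ji] : exists i, j = (k + 1 + i)%N by exists (j - (k + 1))%N; lia.
  have [a na] : exists a, n = (j + a.+1)%N by exists (n - j).-1; lia.
  have -> : (n - j = a.+1)%N by lia.
  have -> : (n - k - 1 = a.+1 + i)%N by lia.
  have -> : (n - k - 2 = a + i)%N by lia.
  (* The bound at [k + 1] exceeds the bound at [j] by [i * (2 * a.+1 - (i + 4 * k + 5))], which is
     nonnegative because [2 * j < n] and [6 * k + 5 <= n]. *)
  have : (i * (i + 4 * k + 5) <= i * (2 * a.+1))%N by rewrite leq_mul2l; lia.
  rewrite ji subn1 /= -mulnn; nia.
rewrite cAk in dA sA.
set n := #|T| in nk se oc *.
(* Nonadjacent [x] and [y] have degree sum below [n]; adding both to [A] in [sum_deg_leq] then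
   contradicts [se]. *)
have clique x y : x \notin A -> y \notin A -> x != y -> e' x y.
  move=> xA yA xy; apply: contrapT => /negP nxy.
  have := sum_deg_leq (x |: (y |: A)) es ei.
  have := oc _ _ xy nxy.
  rewrite !big_setU1 ?cardsU1 ?inE ?negb_or ?xy ?xA ?yA //= cAk -/n.
  move: nk se sA; set dx := deg _ x; set dy := deg _ y => nk se sA dxy.
  have [b nb] : exists b, n = (k + b.+3)%N by exists (n - k).-1.-2; lia.
  have -> : (n - (1 + (1 + k)) = b.+1)%N by lia.
  have -> : (b.+1 - 1 = b)%N by lia.
  move: se; have -> : (n - k - 1 = b.+2)%N by lia.
  have -> : (n - k - 2 = b.+1)%N by lia.
  rewrite -mulnn; nia.
have dAk a : a \in A -> deg e' a = k.
  by move=> aA; apply/eqP; rewrite eqn_leq dA ?dk.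
(* With the clique and [a], the vertex [b] has degree at least [n - k]; as [a'] has degree [k],
   closedness forces the edge. *)
have full a a' b : a \in A -> a' \in A -> b \notin A -> e' b a -> e' b a'.
  move=> aA a'A bA ba; apply: contrapT => /negP nba'.
  have ba' : b != a' by apply: contraNneq bA => ->.
  have := oc _ _ ba' nba'; rewrite (dAk a') //.
  have : a |: (~: A :\ b) \subset [set y | e' b y].
    apply/fintype.subsetP => y; rewrite !inE.
    case/orP => [/eqP-> //|/andP[yb yA]]; apply: clique => //.
    by rewrite eq_sym.
  move/subset_leq_card; rewrite cardsU1 !inE aA /= -/(deg e' b).
  have := cardsC A; have := cardsD1 b (~: A); rewrite !inE bA /= -/n cAk; lia.
have /card_gt0P[a0 a0A] : (0 < #|A|)%N by rewrite cAk.
pose X := [set b | (b \notin A) && e' a0 b].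
have Xout a v : a \in A -> e' a v -> v \in A :|: X.
  move=> aA av; rewrite !inE; case: (boolP (v \in A)) => //= vA.
  by rewrite es; apply: (full a) => //; rewrite es.
have XA a : a \in A -> (deg e' a = #|X| + #|[set v in A | e' a v]|)%N.
  move=> aA; rewrite /deg -cardsUI.
  have -> : X :&: [set v in A | e' a v] = set0.
    by apply/setP => v; rewrite !inE; case: (v \in A); rewrite ?andbF.
  rewrite cards0 addn0; apply: eq_card => v; rewrite !inE.
  case: (boolP (v \in A)) => vA //=; rewrite orbF.
  by apply/idP/idP; rewrite ![e' _ v]es => H; [apply: (full a)|apply: (full a0)].
have Xk := XA _ a0A; rewrite dAk // in Xk.
exists A, X; split; first split => //.
- by rewrite disjoints_subset; apply/fintype.subsetP => a aA; rewrite !inE aA.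
- lia.
- by move=> a v aA /sub; apply: Xout.
- move=> a aA; have := XA a aA; rewrite dAk // => ->; rewrite addKn.
  by apply/subset_leq_card/fintype.subsetP => v; rewrite !inE => /andP[-> /sub->].
- have : [set v in A | e' a0 v] \subset A :\ a0.
    apply/fintype.subsetP => v; rewrite !inE => /andP[-> av]; rewrite andbT.
    by apply: contraTneq av => ->; rewrite ei.
  move/subset_leq_card; have := cardsD1 a0 A; rewrite a0A cAk; lia.
Qed.

(** * Bounds on signless Laplacian eigenvalues *)

Local Open Scope ring_scope.

(** An eigenvector of [A + D] as a function on the vertices: the diagonal part contributes [y u]
    once for each neighbour. *)
Definition q_eigen (R : realFieldType) (T : finType) (e : rel T) (a : R)
    (y : T -> R) :=
  (exists u, y u != 0) /\
  (forall u, \sum_(v | e u v) (y u + y v) = a * y u).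

(* Collatz-Wielandt: [S] is the set where [`|y| / w] is maximal. *)
Lemma collatz (R : realFieldType) (T : finType) (e : rel T) (w y : T -> R)
    (lam a : R) :
  (forall u, 0 < w u) ->
  (forall u, \sum_(v | e u v) (w u + w v) <= lam * w u) ->
  q_eigen e a y -> lam <= a ->
  exists S : {set T}, [/\ exists u, u \in S,
    forall u, u \in S -> \sum_(v | e u v) (w u + w v) = lam * w u &
    forall u v, u \in S -> e u v -> v \in S].
Proof.
move=> w0 hw [[u0 yu0] ya] la.
pose r u := `|y u| / w u.
have [u1 _ r1] := @arg_maxP _ R T u0 predT r isT.
set rho := r u1 in r1.
have rho0 : 0 < rho.
  by apply: lt_le_trans (r1 u0 isT); rewrite divr_gt0 ?normr_gt0.
have yw u : `|y u| <= rho * w u by rewrite -ler_pdivrMr //; apply: r1.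
pose S := [set u | `|y u| == rho * w u].
have main u : u \in S ->
    \sum_(v | e u v) (w u + w v) = lam * w u /\ forall v, e u v -> v \in S.
  rewrite inE => /eqP yu.
  (* The bounds [up], [le1] and [lo] form a closed chain, so all are equalities, and equality in
     each term of [le1] puts every neighbour of [u] in [S]. *)
  have up : lam * (rho * w u) <= \sum_(v | e u v) (`|y u| + `|y v|).
    apply: le_trans (_ : `|a * y u| <= _).
      rewrite normrM yu ler_wpM2r //; last exact: le_trans la (ler_norm a).
      by rewrite mulr_ge0 ?ltW.
    rewrite -ya; apply: le_trans (ler_norm_sum _ _ _) _.
    by apply: ler_sum => v _; apply: ler_normD.
  have lo : \sum_(v | e u v) (rho * (w u + w v)) <= lam * (rho * w u).
    by rewrite -mulr_sumr mulrCA ler_pM2l.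
  have le1 v : e u v -> `|y u| + `|y v| <= rho * (w u + w v).
    by move=> _; rewrite mulrDr yu lerD2l.
  have [leq eq] := leif_sum (fun v ev => leif_eq (le1 v ev)).
  have E : \sum_(v | e u v) (`|y u| + `|y v|) =
           \sum_(v | e u v) (rho * (w u + w v)).
    by apply/eqP; rewrite eq_le leq (le_trans lo up).
  split.
    apply: (mulfI (lt0r_neq0 rho0)); rewrite mulr_sumr mulrCA.
    by apply/eqP; rewrite eq_le lo -E up.
  move=> v ev; move: eq; rewrite E eqxx => /esym/forall_inP/(_ v ev).
  by rewrite inE mulrDr yu (inj_eq (addrI _)).
exists S; split.
- exists u1; rewrite inE /rho /r divfK //; exact: lt0r_neq0.
- by move=> u /main[].
- by move=> u v /main[_ H] /H.
Qed.

Lemma q_eigen_le (R : realFieldType) (T : finType) (e : rel T) (w y : T -> R)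
    (mu a : R) :
  (forall u, 0 < w u) ->
  (forall u, \sum_(v | e u v) (w u + w v) <= mu * w u) ->
  q_eigen e a y -> a <= mu.
Proof.
move=> w0 hw ya; rewrite leNgt; apply/negP => ma.
have hw' u : \sum_(v | e u v) (w u + w v) < a * w u.
  by apply: le_lt_trans (hw u) _; rewrite ltr_pM2r.
have [S [[u uS] tight _]] := collatz w0 (fun u => ltW (hw' u)) ya (lexx a).
by have := hw' u; rewrite tight // ltxx.
Qed.

(* Merris' bound with weights [w = deg], combined with Das' estimate of the
   average degree of the neighbours of a vertex. *)
Lemma q_eigen_le_edges (R : realFieldType) (T : finType) (e : rel T)
    (a : R) (y : T -> R) :
  symmetric e -> irreflexive e -> (1 < #|T|)%N -> q_eigen e a y ->
  a * (#|T| - 1)%:R <= (\sum_x deg e x)%:R + ((#|T| - 1) * (#|T| - 2))%:R.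
Proof.
move=> es ei T1 ya.
set n := #|T| in T1 *; set M := (\sum_x deg e x)%N.
have n1 : 0 < (n - 1)%:R :> R by rewrite ltr0n; lia.
rewrite -ler_pdivlMr //; set mu := _ / _.
(* The value 1 at isolated vertices keeps the weight positive. *)
pose w u : R := if deg e u == 0 then 1 else (deg e u)%:R.
apply: (@q_eigen_le _ _ _ w y) ya => u.
  by rewrite /w; case: eqP => [_|/eqP]; rewrite ?ltr01 // ltr0n lt0n.
have [d0|d0] := eqVneq (deg e u) 0%N.
  rewrite big_pred0 => [|v]; last first.
    by have /setP/(_ v) := cards0_eq d0; rewrite !inE.
  rewrite /w d0 eqxx mulr1 /mu divr_ge0 ?addr_ge0 //.
have wE v : e u v -> w v = (deg e v)%:R.
  move=> uv; rewrite /w; case: eqP => // dv.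
  by have /setP/(_ u) := cards0_eq dv; rewrite !inE es uv.
have du : #|e u| = deg e u by rewrite /deg cardsE.
rewrite big_split /= sumr_const du.
rewrite (eq_bigr _ wE) /w (negbTE d0) -natr_sum.
rewrite /mu mulrAC ler_pdivlMr //.
rewrite -[X in X *+ _]/(_%:R) -mulrnA -!natrD -!natrM ler_nat.
set d := deg e u; pose N := [set v | e u v].
set S := (\sum_(v | e u v) deg e v)%N.
pose W := (\sum_(v in ~: (u |: N)) deg e v)%N.
have SE : S = (\sum_(v in N) deg e v)%N.
  by rewrite /S; apply: eq_bigl => v; rewrite inE.
have uN : u \notin N by rewrite inE ei.
have ME : M = (d + S + W)%N.
  rewrite /M (bigID (mem (u |: N))) /= big_setU1 //= -SE; congr addn.
  by apply: eq_bigl => v; rewrite in_setC.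
have cN : #|N| = d by [].
have cn : (n = d + 1 + #|~: (u |: N)|)%N.
  by have := cardsC (u |: N); rewrite cardsU1 uN cN /n; lia.
have Sn : (S <= d * (n - 1))%N.
  rewrite SE -cN -sum_nat_const; apply: leq_sum => v _.
  rewrite subn1 /n -(cardsC1 v).
  apply/subset_leq_card/fintype.subsetP => x; rewrite !inE.
  by apply: contraTneq => ->; rewrite ei.
(* A neighbour of [u] has at most [d] neighbours in [u |: N], and [W] counts its edges to the other
   vertices. *)
have SW : (S <= d * d + W)%N.
  have -> : S = (\sum_(v in N) \sum_(x in u |: N) e v x +
                \sum_(v in N) \sum_(x in ~: (u |: N)) e v x)%N.
    rewrite -big_split SE; apply: eq_bigr => v _.
    rewrite degE (bigID (mem (u |: N))) /=; congr addn.
    by apply: eq_bigl => x; rewrite in_setC.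
  apply: leq_add; last first.
    rewrite exchange_big /=; apply: leq_sum => x _; rewrite degE.
    rewrite [leqRHS](bigID (mem N)) /=; apply: leq_trans (leq_addr _ _).
    by apply: leq_sum => v _; rewrite es.
  rewrite -[in leqRHS]cN -sum_nat_const; apply: leq_sum => v vN.
  rewrite (bigD1 v) ?in_setU1 ?vN ?orbT //= ei add0n.
  have <- : #|(u |: N) :\ v| = #|N|.
    by have := cardsD1 v (u |: N); rewrite cardsU1 uN in_setU1 vN orbT; lia.
  rewrite -sum1_card [leqRHS](eq_bigl (fun x => (x \in u |: N) && (x != v))).
    by apply: leq_sum => x _; case: (e v x).
  by move=> x; rewrite !inE andbC.
move: d0; rewrite -/d -lt0n => d0.
set c := #|~: _| in cn.
have -> : (n - 1 = d + c)%N by lia.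
have -> : (n - 2 = d.-1 + c)%N by lia.
have {}Sn : (S <= d * (d + c))%N by have -> : (d + c = n - 1)%N by lia.
rewrite ME; clearbody d S W c; clear -d0 Sn SW.
case: d d0 Sn SW => // d _ Sn SW; rewrite succnK.
(* This is what remains after cancellation, with [d.+1] the degree of [u] and [c] the number of its
   non-neighbours. If [S] exceeds [d.+1 * d.+1], the excess [z] is at most [W] and at most [d.+1]
   times [c]. *)
suff : (c * S + d.+1 * c <= d.+1 * W + d.+1 * d.+1 * c + d.+1 * (c * c))%N by nia.
case: c Sn => [|c] Sn; first by rewrite !muln0.
have c1 : (c.+1 <= c.+1 * c.+1)%N by rewrite leq_pmulr.
have dc1 : (d.+1 * c.+1 <= d.+1 * (c.+1 * c.+1))%N by rewrite leq_mul2l c1 orbT.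
have [Sd|/ltnW Sd] := leqP S (d.+1 * d.+1).
  have : (S * c.+1 <= d.+1 * d.+1 * c.+1)%N by rewrite leq_mul2r Sd orbT.
  lia.
have [z Sz] : exists z, S = (d.+1 * d.+1 + z)%N by exists (S - d.+1 * d.+1)%N; lia.
have zc : (z <= d.+1 * c.+1)%N by move: Sn; rewrite Sz mulnDr leq_add2l.
have zW : (d.+1 * z <= d.+1 * W)%N.
  by rewrite leq_mul2l; move: SW; rewrite Sz leq_add2l => ->; rewrite orbT.
suff : (c.+1 * z + d.+1 * c.+1 <= d.+1 * z + d.+1 * (c.+1 * c.+1))%N.
  rewrite Sz mulnDr; lia.
have [cd|/ltnW cd] := leqP c.+1 d.+1.
  have : (c.+1 * z <= d.+1 * z)%N by rewrite leq_mul2r cd orbT.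
  lia.
have [f cf] : exists f, c.+1 = (d.+1 + f)%N by exists (c.+1 - d.+1)%N; lia.
have : (f * z <= f * (d.+1 * c.+1))%N by rewrite leq_mul2l zc orbT.
rewrite cf in zc *; nia.
Qed.

(** * Supersolutions on graphs with a low pair *)

(** The weight is [z] on [A], [x] on [X] and [y] elsewhere; it is a supersolution even with all
    permitted edges present. Tightness in [collatz] reaches every vertex outside [A], where a
    missing edge would make the inequality strict. *)
Lemma low_pair_tight (R : realFieldType) (T : finType) (e : rel T)
    (c k M : nat) (A X : {set T}) (x y z lam a : R) (f : T -> R) :
  symmetric e -> irreflexive e -> low_pair e c k A X -> #|T| = (M + c)%N ->
  (#|X| < M)%N -> 0 < x -> 0 < y -> 0 < z ->
  let s := #|X|%:R in
  ((0 < #|X|)%N ->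
    (M + c)%:R * x + c%:R * z + s * x + (M%:R - s) * y - 2 * x <= lam * x) ->
  M%:R * y + s * x + (M%:R - s) * y - 2 * y <= lam * y ->
  s * (z + x) + (k%:R - s) * (2 * z) <= lam * z ->
  (#|X| = 0%N -> k%:R * (2 * z) < lam * z) ->
  q_eigen e a f -> lam <= a ->
  [/\ (0 < #|X|)%N ->
      (M + c)%:R * x + c%:R * z + s * x + (M%:R - s) * y - 2 * x = lam * x,
      M%:R * y + s * x + (M%:R - s) * y - 2 * y = lam * y &
      forall u v, u != v -> (u \in X) || (u \notin A) && (v \notin A) -> e u v].
Proof.
move=> es ei [dAX cA sk NA AA] cT sM x0 y0 z0 s hX hY hA h0 qf la.
pose w u := if u \in A then z else if u \in X then x else y.
have w0 u : 0 < w u by rewrite /w; case: ifP => // _; case: ifP.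
have XA u : u \in X -> u \notin A.
  by move=> uX; apply: contraTN uX => uA; rewrite (disjointFr dAX uA).
have wA u : u \in A -> w u = z by rewrite /w => ->.
have wX u : u \in X -> w u = x by move=> uX; rewrite /w uX (negbTE (XA u uX)).
have wY u : u \notin A -> u \notin X -> w u = y.
  by rewrite /w => /negbTE-> /negbTE->.
have cnA : #|~: A| = M by have := cardsC A; lia.
have swA : \sum_(v in A) w v = c%:R * z.
  by rewrite (eq_bigr _ wA) sumr_const cA mulr_natl.
have swX : \sum_(v in X) w v = s * x.
  by rewrite (eq_bigr _ wX) sumr_const -mulr_natl.
have swB : \sum_(v in ~: A) w v = s * x + (M%:R - s) * y.
  rewrite (bigID (mem X)) /=; congr (_ + _).
    rewrite -swX; apply: eq_bigl => v; rewrite in_setC andb_idl //; exact: XA.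
  rewrite (eq_bigr (fun=> y)); last by move=> v; rewrite in_setC => /andP[*]; rewrite wY.
  rewrite (eq_bigl (mem (~: A :\: X))) => [|v]; last by rewrite !inE andbC.
  rewrite sumr_const -[y *+ _]mulr_natl; congr (_ * _).
  rewrite cardsD (setIidPr _) ?cnA; last first.
    by apply/fintype.subsetP => v /XA; rewrite inE.
  by rewrite natrB // ltnW.
have swT : \sum_v w v = c%:R * z + (s * x + (M%:R - s) * y).
  rewrite (bigID (mem A)) /= swA -swB; congr (_ + _).
  by apply: eq_bigl => v; rewrite in_setC.
(* For [u] outside [A], [e1] contains all edges at [u] that the low pair permits. *)
pose e1 u v := (v != u) && ((u \in X) || (v \notin A)).
have ee1 u v : u \notin A -> e u v -> e1 u v.
  move=> uA uv; rewrite /e1; apply/andP; split.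
    by apply: contraTneq uv => ->; rewrite ei.
  case: (boolP (v \in A)) => vA; last by rewrite orbT.
  have := NA v u vA; rewrite es inE (negbTE uA) /= => /(_ uv)->; by [].
have sX u : u \in X -> \sum_(v | e1 u v) (w u + w v) =
    (M + c)%:R * x + c%:R * z + s * x + (M%:R - s) * y - 2 * x.
  move=> uX; apply: (addIr (w u + w u)); rewrite addrC.
  transitivity (\sum_v (w u + w v)).
    rewrite [RHS](bigD1 u) //=; congr (_ + _).
    by apply: eq_bigl => v; rewrite /e1 uX andbT.
  rewrite big_split /= swT sumr_const cT wX // -[x *+ _]mulr_natl; ring.
have sY u : u \notin A -> u \notin X -> \sum_(v | e1 u v) (w u + w v) =
    M%:R * y + s * x + (M%:R - s) * y - 2 * y.
  move=> uA uX; apply: (addIr (w u + w u)); rewrite addrC.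
  transitivity (\sum_(v in ~: A) (w u + w v)).
    rewrite [RHS](bigD1 u) ?inE //=; congr (_ + _).
    by apply: eq_bigl => v; rewrite /e1 (negbTE uX) in_setC andbC.
  rewrite big_split /= swB sumr_const cnA wY // -[y *+ _]mulr_natl; ring.
have s1 u : u \notin A -> \sum_(v | e1 u v) (w u + w v) <= lam * w u.
  move=> uA; case: (boolP (u \in X)) => uX.
    by rewrite sX // wX //; apply: hX; apply/card_gt0P; exists u.
  by rewrite sY // wY.
have le1 u : u \notin A -> \sum_(v | e1 u v) (w u + w v) =
    \sum_(v | e u v) (w u + w v) +
    \sum_(v | e1 u v && ~~ e u v) (w u + w v).
  move=> uA; rewrite (bigID (e u)) /=; congr (_ + _).
  apply: eq_bigl => v; rewrite andb_idl //; exact: ee1.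
have pos P u : 0 <= \sum_(v | P v) (w u + w v).
  by apply: sumr_ge0 => v _; rewrite addr_ge0 // ltW.
have sAE u : u \in A -> \sum_(v | e u v) (w u + w v) =
    \sum_(v in X | e u v) (z + x) + \sum_(v in A | e u v) (2 * z).
  move=> uA; rewrite (bigID (mem X)) /=; congr (_ + _).
    rewrite (eq_bigl (fun v => (v \in X) && e u v)) => [|v]; last by rewrite andbC.
    by apply: eq_bigr => v /andP[vX _]; rewrite wA // wX.
  rewrite (eq_bigl (fun v => (v \in A) && e u v)) => [|v].
    by apply: eq_bigr => v /andP[vA _]; rewrite !wA // mulr2n mulrDl mul1r.
  apply/andP/andP => [[uv vX]|[vA uv]]; split => //.
    by have := NA u v uA uv; rewrite inE (negbTE vX) orbF.
  by apply: contraL vA; apply: XA.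
have sAA u : u \in A -> \sum_(v in A | e u v) (2 * z) <= (k%:R - s) * (2 * z).
  move=> uA; rewrite sumr_const -[(2 * z) *+ _]mulr_natl.
  rewrite ler_pM2r ?mulr_gt0 // -natrB // ler_nat.
  by have := AA u uA; rewrite cardsE.
have sA' u : u \in A -> \sum_(v | e u v) (w u + w v) <= lam * w u.
  move=> uA; rewrite sAE // wA //; apply: le_trans hA.
  apply: lerD (sAA u uA).
  have -> : s * (z + x) = \sum_(v in X) (z + x) by rewrite sumr_const mulr_natl.
  rewrite [leRHS](bigID (e u)) /= lerDl; apply: sumr_ge0 => v _.
  by rewrite addr_ge0 // ltW.
have sA u : u \in A -> (exists2 v, v \in X & e u v) \/
    \sum_(v | e u v) (w u + w v) < lam * w u.
  move=> uA; have [/existsP[v /andP[vX uv]]|nX] := boolP [exists v, (v \in X) && e u v].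
    by left; exists v.
  right; rewrite sAE // wA // big_pred0 => [|v]; last first.
    by apply: contraNF nX => H; apply/existsP; exists v.
  rewrite add0r; apply: le_lt_trans (sAA u uA) _.
  have [X0|X0] := posnP #|X|.
    by apply: le_lt_trans (h0 X0); rewrite /s X0 subr0.
  apply: lt_le_trans hA; rewrite ltrDr mulr_gt0 ?addr_gt0 // /s ltr0n //.
have hw u : \sum_(v | e u v) (w u + w v) <= lam * w u.
  case: (boolP (u \in A)) => uA; first exact: sA'.
  by apply: le_trans (s1 u uA); rewrite le1 // lerDl pos.
have [S [[u0 u0S] tight cl]] := collatz w0 hw qf la.
(* A tight vertex of [A] has a neighbour in [X], its inequality being strict otherwise, and this
   neighbour is tight too. *)
have [u1 u1S u1A] : exists2 u, u \in S & u \notin A.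
  case: (boolP (u0 \in A)) => u0A; last by exists u0.
  case: (sA u0 u0A) => [[v vX ev]|]; last by rewrite tight // ltxx.
  by exists v; [apply: cl ev | apply: XA].
have full u v : u \in S -> u \notin A -> e1 u v -> e u v.
  move=> uS uA uv; apply: contrapT => /negP nuv.
  have := s1 u uA; rewrite le1 // tight // gerDl (bigD1 v) ?uv //=.
  apply/negP; rewrite -ltNge; apply: ltr_pwDl; first by rewrite addr_gt0.
  by apply: sumr_ge0 => i _; rewrite addr_ge0 // ltW.
have BS u : u \notin A -> u \in S.
  move=> uA; have [->//|uu1] := eqVneq u u1; apply: (cl u1) => //.
  by apply: full => //; rewrite /e1 uu1 uA orbT.
have eqs u : u \notin A -> \sum_(v | e1 u v) (w u + w v) = lam * w u.
  move=> uA; apply/eqP; rewrite eq_le s1 // -(tight u) ?BS //.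
  by rewrite le1 // lerDl pos.
split.
- by case/card_gt0P => u uX; rewrite -(sX u) // eqs ?XA // wX.
- have /card_gt0P[u] : (0 < #|~: A :\: X|)%N.
    rewrite cardsD cnA subn_gt0; apply: leq_ltn_trans sM.
    exact/subset_leq_card/subsetIr.
  by rewrite !inE => /andP[uX uA]; rewrite -(sY u) // eqs // wY.
- move=> u v uv H; have uA : u \notin A.
    by case/orP: H => [/XA//|/andP[]].
  apply: full; rewrite ?BS // /e1 eq_sym uv /=.
  by case/orP: H => [->//|/andP[_ ->]]; rewrite orbT.
Qed.

(** * Eigenfunctions and the spectral radius *)

Lemma big_enum_val_T (R : nmodType) (T : finType) (F : T -> R) :
  \sum_(i < #|T|) F (enum_val i) = \sum_u F u.
Proof. by rewrite [RHS](reindex (@enum_val T T)) //; apply/onW_bij/enum_val_bij. Qed.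

Lemma eigenvalueE (R : realFieldType) (G : sgraph) (a : R) :
  eigenvalue (signless_laplacian R G) a <-> exists y, q_eigen (@adj G) a y.
Proof.
have key (v : 'rV[R]_#|G|) (y : G -> R) j : (forall i, v 0 i = y (enum_val i)) ->
    (v *m signless_laplacian R G) 0 j =
    \sum_(w | adj (enum_val j) w) (y (enum_val j) + y w).
  move=> vy; rewrite mxE big_split /=.
  under eq_bigr do rewrite !mxE vy mulrDr.
  rewrite big_split /= addrC; congr (_ + _).
    rewrite (bigD1 j) //= eqxx mulr1n big1 ?addr0.
      by rewrite sumr_const mulr_natr /degree cardsE.
    by move=> i /negbTE->; rewrite mulr0n mulr0.
  rewrite (big_enum_val_T (fun w => y w * (adj w (enum_val j))%:R)).
  rewrite [RHS]big_mkcond; apply: eq_bigr => w _.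
  by rewrite adj_sym; case: adj; rewrite ?mulr1 ?mulr0.
split.
- case/eigenvalueP => v vE v0; exists (fun u => v 0 (enum_rank u)); split.
    have /rV0Pn[i vi] := v0.
    by exists (enum_val i); rewrite enum_valK.
  move=> u; have := key v (fun u => v 0 (enum_rank u)) (enum_rank u).
  by rewrite enum_rankK vE mxE => <- // i; rewrite enum_valK.
- case=> y [[u yu] yE]; apply/eigenvalueP; exists (\row_i y (enum_val i)).
    apply/rowP => j; rewrite (key _ y) ?yE ?mxE // => i; by rewrite mxE.
  by apply/rV0Pn; exists (enum_rank u); rewrite mxE enum_rankK.
Qed.

Lemma le_q_radius (R : realType) (G : sgraph) (a : R) y :
  q_eigen (@adj G) a y -> a <= q_radius R G.
Proof.
move=> ya; apply: ub_le_sup; last by apply/eigenvalueE; exists y.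
(* The constant weight 1 bounds all eigenvalues by twice the order. *)
exists (#|G|%:R * 2) => b /= /eigenvalueE[f fb].
apply: (q_eigen_le (w := fun=> 1)) fb => // u.
rewrite sumr_const mulr1 -[(1 + 1) *+ _]mulr_natl ler_pM2r ?addr_gt0 //.
by rewrite ler_nat max_card.
Qed.

(** A set without supremum has [sup] equal to 0, so [0 < b] ensures that eigenvalues exist; as roots
    of the characteristic polynomial they are finitely many, and the supremum is attained. *)
Lemma q_radius_eigen (R : realType) (G : sgraph) (b : R) :
  0 < b -> b <= q_radius R G ->
  exists a y, b <= a /\ q_eigen (@adj G) a y.
Proof.
move=> b0 bq; set E := [set a : R | eigenvalue (signless_laplacian R G) a]%classic.
have hE : has_sup E.
  apply: contrapT => /sup_out E0; move: bq; rewrite /q_radius -/E E0.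
  by rewrite leNgt b0.
pose p := char_poly (signless_laplacian R G).
have p0 : p != 0 by rewrite monic_neq0 // char_poly_monic.
have rE a : E a <-> a \in rootsR p.
  rewrite /E /= eigenvalue_root_char -/p.
  have := roots_on_rootsR p0 a; by rewrite in_itv /= => <-.
have [a aE am] : exists2 a, E a & forall c, E c -> c <= a.
  have [a0 a0E] := hE.1.
  have : exists2 a, a \in rootsR p & forall c, c \in rootsR p -> c <= a.
    have : rootsR p != [::] by apply: contraPneq a0E => H; rewrite rE H.
    elim: (rootsR p) => // x [|x' l] IH _.
      by exists x; rewrite ?mem_head // => c; rewrite inE => /eqP->.
    have [//|a al am] := IH; exists (Num.max a x).
      by rewrite /Num.max; case: ifP => _; rewrite ?mem_head // inE al orbT.
    move=> c; rewrite inE le_max => /orP[/eqP->|/am->]; rewrite ?lexx ?orbT //.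
  by case=> a ar am; exists a => [|c]; rewrite rE //; apply: am.
have /eigenvalueE[y ya] := aE.
exists a, y; split => //; apply: le_trans bq _.
by apply: ge_sup => //; exact: hE.1.
Qed.

(** * The extremal graphs *)

(** Covers both extremal graphs: [N_graph n k] has [m = n - 2 * k] and [c = k], [N_under_graph n k]
    has [m = n - 2 * k - 1] and [c = k.+1]. *)
Definition N_gen (k m c : nat) : sgraph :=
  join (complete k) (dunion (complete m) (copies (complete 1) c)).

Lemma sum_neq_ord (R : zmodType) n (i : 'I_n) (b : R) :
  \sum_(j < n | complete_rel i j) b = b *+ n - b.
Proof.
apply: (addIr b); rewrite subrK addrC.
have -> : b *+ n = \sum_(j < n) b by rewrite sumr_const card_ord.
rewrite [RHS](bigD1 i) //=; congr (_ + _).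
by apply: eq_bigl => j; rewrite /complete_rel eq_sym.
Qed.

(** The hypotheses are the eigenvalue equations of the quotient matrix, with [x] on the joined
    [K_k], [y] on [K_m] and [z] on the isolated copies. *)
Lemma N_gen_eigen (R : realFieldType) (k m c : nat) (x y z lam : R) :
  (0 < m)%N -> y != 0 ->
  ((0 < k)%N ->
    (m + k + c)%:R * x + c%:R * z + k%:R * x + m%:R * y - 2 * x = lam * x) ->
  (m + k)%:R * y + k%:R * x + m%:R * y - 2 * y = lam * y ->
  k%:R * (z + x) = lam * z ->
  exists f, q_eigen (@adj (N_gen k m c)) lam f.
Proof.
move=> m0 y0 hX hY hA.
exists (fun u : N_gen k m c =>
  match u with inl _ => x | inr (inl _) => y | inr (inr _) => z end).
split; first by exists (inr (inl (Ordinal m0))).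
case=> [i|[i|i]]; rewrite big_sumType /= big_sumType /=.
- rewrite sum_neq_ord !sumr_const !card_ord card_prod !card_ord muln1.
  rewrite -[_ *+ k]mulr_natl -[_ *+ m]mulr_natl -[_ *+ c]mulr_natl -hX ?(leq_ltn_trans _ (ltn_ord i)) //.
  by rewrite !natrD; ring.
- rewrite sum_neq_ord big_pred0_eq addr0 !sumr_const !card_ord.
  rewrite -[_ *+ k]mulr_natl -[_ *+ m]mulr_natl -hY.
  by rewrite !natrD; ring.
- rewrite big_pred0_eq add0r [X in _ + X](eq_bigl xpred0) => [|j].
    by rewrite big_pred0_eq addr0 sumr_const card_ord -hA mulr_natl.
  by rewrite /copies_rel /= /complete_rel !ord1 eqxx andbF.
Qed.

(* With [x = 1], [y = k / (k + t)] and [z = k / (2m - 2 + k + t)], the eigenvalue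
   equations of [N_gen k m c] for [2 (m + k - 1) + t] reduce to this one. *)
Definition N_gen_eqn (R : realFieldType) (k m c : nat) (t : R) :=
  t * ((m + k)%:R + t) * (2 * m%:R - 2 + k%:R + t) =
  c%:R * (k%:R + t) * (2 * m%:R - 2 + 2 * k%:R + t).

Lemma N_gen_root (R : rcfType) (k m c : nat) :
  (1 < m)%N -> (0 < c)%N ->
  exists t : R, [/\ 0 <= t, (0 < t) = (0 < k)%N & N_gen_eqn k m c t].
Proof.
move=> m1 c0; have [->|k0] := posnP k.
  by exists 0; split => //; rewrite ?ltxx // /N_gen_eqn !(mul0r, mulr0, add0r).
have m1r : 2 <= m%:R :> R by rewrite (ler_nat _ 2).
have c0r : 1 <= c%:R :> R by rewrite (ler_nat _ 1).
have k0r : 1 <= k%:R :> R by rewrite (ler_nat _ 1).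
pose P : {poly R} := 'X * ((m + k)%:R%:P + 'X) * ((2 * m%:R - 2 + k%:R)%:P + 'X)
  - c%:R%:P * (k%:R%:P + 'X) * ((2 * m%:R - 2 + 2 * k%:R)%:P + 'X).
have PE t : P.[t] = t * ((m + k)%:R + t) * (2 * m%:R - 2 + k%:R + t) -
  c%:R * (k%:R + t) * (2 * m%:R - 2 + 2 * k%:R + t) by rewrite /P !hornerE.
have P0 : P.[0] < 0.
  rewrite PE !(mul0r, addr0) sub0r oppr_lt0 !mulr_gt0 //; lra.
have [||t /andP[t0 _]] := @poly_ivt R P 0 (2 * c%:R); first lra.
  rewrite (ltW P0) /= PE subr_ge0 natrD.
  have H : c%:R * (2 * m%:R - 2 + 2 * k%:R + 2 * c%:R) <=
      2 * c%:R * (2 * m%:R - 2 + k%:R + 2 * c%:R) :> R by nra.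
  have H1 : k%:R + 2 * c%:R <= m%:R + k%:R + 2 * c%:R :> R by lra.
  rewrite -[leRHS]mulrA [leRHS]mulrCA -[leLHS]mulrA [leLHS]mulrCA.
  apply: ler_pM => //; first lra.
  by rewrite mulr_ge0 //; lra.
rewrite /root => /eqP Pt.
have {}t0 : 0 < t.
  rewrite lt_neqAle t0 andbT eq_sym; apply: contraTneq P0 => E.
  by move: Pt; rewrite E => ->; rewrite ltxx.
exists t; split => //; first exact: ltW.
by apply/eqP; rewrite -subr_eq0 -PE Pt.
Qed.

Lemma N_gen_q_radius (R : realType) (k m c : nat) (t : R) :
  (1 < m)%N -> 0 <= t -> (0 < t) = (0 < k)%N -> N_gen_eqn k m c t ->
  2 * (m + k)%:R - 2 + t <= q_radius R (N_gen k m c).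
Proof.
move=> m1 t0 tk E; have m1r : 2 <= m%:R :> R by rewrite (ler_nat _ 2).
have [k0|k0] := posnP k.
  have {}t0 : t = 0 by apply/eqP; move: t0; rewrite le_eqVlt tk k0 orbF eq_sym.
  (* For [k = 0] the clique [K_m] is a component, and its indicator is an eigenfunction. *)
  have [|||||f /le_q_radius//] := @N_gen_eigen R k m c 0 1 0 (2 * (m + k)%:R - 2 + t).
  - exact: ltnW.
  - exact: oner_neq0.
  - by rewrite k0.
  - by rewrite k0 t0 addn0; ring.
  - by rewrite addr0 !mulr0.
have k1 : 1 <= k%:R :> R by rewrite (ler_nat _ 1).
have n1 : k%:R + t != 0 by apply: lt0r_neq0; lra.
have n2 : 2 * m%:R - 2 + k%:R + t != 0 by apply: lt0r_neq0; lra.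
have [|||||f /le_q_radius//] := @N_gen_eigen R k m c 1 (k%:R / (k%:R + t))
  (k%:R / (2 * m%:R - 2 + k%:R + t)) (2 * (m + k)%:R - 2 + t).
- exact: ltnW.
- by rewrite mulf_neq0 ?invr_eq0 //; apply: lt0r_neq0; lra.
- move=> _; apply: subr0_eq; rewrite [LHS](_ : _ =
    (c%:R * (k%:R + t) * (2 * m%:R - 2 + 2 * k%:R + t) -
     t * ((m + k)%:R + t) * (2 * m%:R - 2 + k%:R + t)) /
    ((k%:R + t) * (2 * m%:R - 2 + k%:R + t))).
    by rewrite E subrr mul0r.
  by rewrite !natrD; field; rewrite n1 n2.
- by rewrite !natrD; field; rewrite n1.
- by rewrite !natrD; field; rewrite n2.
Qed.

(** * Comparison with the extremal graph *)

(** Vertices with the same label are matched by their position in the enumeration of the label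
    class. *)
Lemma label_bij (T T' : finType) (L : eqType) (l : T -> L) (l' : T' -> L)
    (y0 : T') :
  #|T| = #|T'| -> (forall a, #|[set x | l x == a]| = #|[set y | l' y == a]|) ->
  exists2 f : T -> T', bijective f & forall x, l' (f x) = l x.
Proof.
move=> cT cl.
pose cx a := enum [set x | l x == a]; pose cy a := enum [set y | l' y == a].
have szc a : size (cx a) = size (cy a) by rewrite -!cardE.
have xin x : x \in cx (l x) by rewrite mem_enum inE.
pose f x := nth y0 (cy (l x)) (index x (cx (l x))).
have isz x : (index x (cx (l x)) < size (cy (l x)))%N by rewrite -szc index_mem.
have lf x : l' (f x) = l x.
  by have := mem_nth y0 (isz x); rewrite mem_enum inE => /eqP.
exists f => //; apply: inj_card_bij; last by rewrite cT.
move=> x x' fxx; have ll : l x = l x' by rewrite -!lf fxx.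
move: fxx; rewrite /f => /eqP; rewrite -ll nth_uniq ?enum_uniq //; last first.
  by rewrite ll.
by move/eqP/(congr1 (nth x (cx (l x)))); rewrite !nth_index // ll.
Qed.

(** When [#|X| = k], the set [A] is independent. Labels 0 on [X], 2 on [A] and 1 elsewhere then
    determine adjacency in both graphs, so a label-preserving bijection is an isomorphism. *)
Lemma low_pair_iso (G : sgraph) (k m c : nat) (A X : {set G}) :
  (0 < m)%N -> low_pair (@adj G) c k A X -> #|X| = k -> #|G| = (m + k + c)%N ->
  (forall u v : G, u != v -> (u \in X) || (u \notin A) && (v \notin A) ->
    adj u v) ->
  isomorphic G (N_gen k m c).
Proof.
move=> m0 [dAX cA _ NA AA] cX cG full.
have XA u : u \in X -> u \notin A.
  by move=> uX; apply: contraTN uX => uA; rewrite (disjointFr dAX uA).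
have indA u v : u \in A -> v \notin X -> adj u v = false.
  move=> uA vX; apply/negP => uv.
  have vA : v \in A by have := NA u v uA uv; rewrite inE (negbTE vX) orbF.
  have := AA u uA; rewrite cX subnn leqn0 cards_eq0 => /eqP/setP/(_ v).
  by rewrite !inE vA uv.
pose l (u : G) : nat := if u \in A then 2 else if u \in X then 0 else 1.
pose l' (u : N_gen k m c) : nat :=
  match u with inl _ => 0 | inr (inl _) => 1 | inr (inr _) => 2 end.
pose b (i j : nat) := [|| i == 0, j == 0 | (i != 2) && (j != 2)]%N.
have l0 u : (l u == 0)%N = (u \in X).
  rewrite /l; case: ifP => uA; last by case: ifP.
  by apply/esym; apply: contraTF uA; apply: XA.
have l2 u : (l u == 2)%N = (u \in A) by rewrite /l; case: ifP => // _; case: ifP.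
have adjG u v : adj u v = (u != v) && b (l u) (l v).
  have [->|uv] := eqVneq u v; first by rewrite adj_irrefl.
  rewrite /b !l0 !l2 /=; apply/idP/idP => [|/or3P[uX|vX|uvA]].
  - case: (boolP (u \in X)) => //= uX; case: (boolP (v \in X)) => //= vX.
    case: (boolP (u \in A)) => [uA|uA]; first by rewrite indA.
    by case: (boolP (v \in A)) => [vA|//]; rewrite adj_sym indA.
  - by apply: full; rewrite ?uX.
  - by rewrite adj_sym; apply: full; rewrite 1?eq_sym ?vX.
  - by apply: full; rewrite ?uvA ?orbT.
have adjN u v : @adj (N_gen k m c) u v = (u != v) && b (l' u) (l' v).
  case: u v => [i|[i|[i i']]] [j|[j|[j j']]] //=;
    rewrite ?andbT //.
  by rewrite /copies_rel /= /complete_rel (ord1 i') (ord1 j') eqxx !andbF.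
have [||f fb fl] := @label_bij G (N_gen k m c) _ l l' (inr (inl (Ordinal m0))).
- by rewrite cG !card_sum card_prod !card_ord; lia.
- have cAX : #|A :|: X| = (c + k)%N.
    have := cardsUI A X; move: dAX; rewrite -setI_eq0 => /eqP->.
    by rewrite cards0 cA cX addn0.
  have l1 u : (l u == 1)%N = (u \notin A :|: X).
    by rewrite inE negb_or /l; case: (u \in A); case: (u \in X).
  case=> [|[|[|a]]]; rewrite -[RHS]sum1dep_card big_sumType /= big_sumType /=;
    rewrite ?big_pred0_eq ?addn0 ?add0n ?sum1_card ?card_prod ?card_ord ?muln1.
  - by rewrite -cX; apply: eq_card => u; rewrite inE l0.
  - have -> : [set x | l x == 1%N] = ~: (A :|: X).
      by apply/setP => u; rewrite in_setC inE l1.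
    by have := cardsC (A :|: X); rewrite cAX cG; lia.
  - by rewrite -cA; apply: eq_card => u; rewrite inE l2.
  - by apply/eqP; rewrite cards_eq0; apply/eqP/setP => u;
      rewrite !inE /l; case: ifP => // _; case: ifP.
exists f => // u v; rewrite adjN adjG !fl; congr (~~ _ && _).
by rewrite (inj_eq (bij_inj fb)).
Qed.

(** The quotient [(s + t) * (D + 2 * s + t) / (D + s + t)] is strictly increasing in [s], so
    equality at [k] is strict below [k]. *)
Lemma weight_ineq (R : realFieldType) (s k t B c D : R) :
  0 < s -> s < k -> 0 < t -> 0 < B -> 0 <= D ->
  c * (k + t) * (D + 2 * k + t) = B * (D + k + t) ->
  c * (s + t) * (D + 2 * s + t) < B * (D + s + t).
Proof.
move=> s0 sk t0 B0 D0 E.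
have P0 : 0 < (k + t) * (D + 2 * k + t) by apply: mulr_gt0; lra.
rewrite -(ltr_pM2r P0).
have -> : c * (s + t) * (D + 2 * s + t) * ((k + t) * (D + 2 * k + t)) =
    (s + t) * ((D + 2 * s + t) * (D + k + t)) * B.
  transitivity ((s + t) * (D + 2 * s + t) * (c * (k + t) * (D + 2 * k + t))).
    by ring.
  by rewrite E; ring.
have -> : B * (D + s + t) * ((k + t) * (D + 2 * k + t)) =
    (k + t) * ((D + 2 * k + t) * (D + s + t)) * B by ring.
rewrite ltr_pM2r //; apply: (@lt_le_trans _ _ ((k + t) * ((D + 2 * s + t) * (D + k + t)))).
  by rewrite ltr_pM2r; [lra|apply: mulr_gt0; lra].
rewrite ler_pM2l; last lra.
rewrite -subr_ge0 [X in 0 <= X](_ : _ = (D + t) * (k - s)); last by ring.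
by apply: mulr_ge0; lra.
Qed.

(** The eigenfunction of [N_gen] with [k] replaced by [s = #|X|] in the weights, but with [lam]
    kept, satisfies the equations on [A] and on the remaining vertices exactly. The equation on [X]
    is strict for [s < k], against tightness. *)
Lemma isomorphic_N_gen (R : realType) (G : sgraph) (k m c : nat)
    (A X : {set G}) :
  (1 < m)%N -> (0 < c)%N -> low_pair (@adj G) c k A X ->
  #|G| = (m + k + c)%N -> q_radius R (N_gen k m c) <= q_radius R G ->
  isomorphic G (N_gen k m c).
Proof.
move=> m1 c0 lp cG qNG; have m0 : (0 < m)%N by exact: ltnW.
have m1r : 2 <= m%:R :> R by rewrite (ler_nat _ 2).
have [t [t0 tk E]] := N_gen_root R k m1 c0.
have lamN := N_gen_q_radius m1 t0 tk E.
set lam := _ + t in lamN.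
have mk : (m + k)%:R = m%:R + k%:R :> R by rewrite natrD.
have k0r : 0 <= k%:R :> R by [].
have lam0 : 0 < lam by rewrite /lam mk; lra.
have [a [f [la qf]]] := q_radius_eigen lam0 (le_trans lamN qNG).
have [_ _ sk _ _] := lp; have sM : (#|X| < m + k)%N by lia.
have tight := low_pair_tight (@adj_sym G) (@adj_irrefl G) lp cG _ _ _ _ _ _ _ _ qf la.
have [s0|s0] := posnP #|X|.
  (* With [X] empty, constant weights suffice; tightness outside [A] gives [t = 0], hence
     [k = 0]. *)
  have [||||||||_ EY full] := tight 1 1 1.
  - exact: sM.
  - exact: ltr01.
  - exact: ltr01.
  - exact: ltr01.
  - by rewrite s0.
  - by rewrite s0 /lam mk; lra.
  - by rewrite s0 /lam mk; lra.
  - by rewrite /lam mk; lra.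
  have [k0|k0] := posnP k.
    by apply: (low_pair_iso m0 lp _ cG full); rewrite s0 k0.
  by move: tk EY; rewrite s0 k0 /lam mk => ?; lra.
have k0 : (0 < k)%N := leq_trans s0 sk.
have {}t0 : 0 < t by rewrite tk.
have s0r : 0 < #|X|%:R :> R by rewrite ltr0n.
set s : R := #|X|%:R in s0r tight.
have skr : s <= k%:R by rewrite ler_nat.
have n1 : s + t != 0 by apply: lt0r_neq0; lra.
have n2 : 2 * m%:R - 2 + s + t != 0 by apply: lt0r_neq0; lra.
pose D : R := 2 * m%:R - 2; pose B := t * ((m + k)%:R + t).
have hX : (m + k + c)%:R * 1 + c%:R * (s / (D + s + t)) + s * 1 +
    ((m + k)%:R - s) * (s / (s + t)) - 2 * 1 - lam * 1 =
    (c%:R * (s + t) * (D + 2 * s + t) - B * (D + s + t)) /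
      ((s + t) * (D + s + t)).
  by rewrite /lam /D /B !natrD; field; rewrite n1 n2.
have B0 : 0 < B by rewrite /B mk; apply: mulr_gt0; lra.
have D0 : 0 <= D by rewrite /D; lra.
have den0 : 0 < (s + t) * (D + s + t) by apply: mulr_gt0; lra.
have E' : c%:R * (k%:R + t) * (D + 2 * k%:R + t) = B * (D + k%:R + t).
  by rewrite /B /D; exact/esym.
have hX' : (#|X| < k)%N -> (m + k + c)%:R * 1 + c%:R * (s / (D + s + t)) + s * 1 +
    ((m + k)%:R - s) * (s / (s + t)) - 2 * 1 < lam * 1.
  move=> sk'; rewrite -subr_lt0 hX pmulr_llt0 ?invr_gt0 // subr_lt0.
  by apply: weight_ineq E' => //; rewrite ltr_nat.
have hXle : (m + k + c)%:R * 1 + c%:R * (s / (D + s + t)) + s * 1 +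
    ((m + k)%:R - s) * (s / (s + t)) - 2 * 1 <= lam * 1.
  have [/hX'/ltW //|sk'] := ltnP #|X| k.
  have sE : s = k%:R by rewrite /s; congr _%:R; apply/eqP; rewrite eqn_leq sk.
  by rewrite -subr_le0 hX sE E' subrr mul0r.
have [||||||||EX _ full] := tight 1 (s / (s + t)) (s / (D + s + t)).
- exact: sM.
- exact: ltr01.
- by apply: divr_gt0; lra.
- by apply: divr_gt0; lra.
- by move=> _; exact: hXle.
- rewrite le_eqVlt; apply/orP; left; apply/eqP.
  by rewrite /lam !natrD; field; rewrite n1.
- rewrite le_eqVlt; apply/orP; left; apply/eqP.
  by rewrite /lam /D !natrD; field; rewrite n2.
- by move=> X0; rewrite X0 in s0.
case: (ltnP #|X| k) => sk'; first by have := hX' sk'; rewrite EX // ltxx.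
by apply: (low_pair_iso m0 lp _ cG full); apply/eqP; rewrite eqn_leq sk.
Qed.

(** The eigenvalue [2 * (m + k - 1) + t] is inserted in the edge bound. For [k > 0] the positive [t]
    makes the inequality strict, which gains 1 between integers. *)
Lemma q_radius_edges (R : realType) (G : sgraph) (k m c : nat) :
  (1 < m)%N -> (0 < c)%N -> (1 < #|G|)%N ->
  q_radius R (N_gen k m c) <= q_radius R G ->
  (2 * (m + k - 1) * (#|G| - 1) + (0 < k) <=
   \sum_x deg (@adj G) x + (#|G| - 1) * (#|G| - 2))%N.
Proof.
move=> m1 c0 G1 qNG.
have m1r : 2 <= m%:R :> R by rewrite (ler_nat _ 2).
have [t [t0 tk E]] := N_gen_root R k m1 c0.
have lamN := N_gen_q_radius m1 t0 tk E.
set lam := _ + t in lamN.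
have lamE : lam = (2 * (m + k - 1))%:R + t.
  by rewrite natrM natrB ?addn_gt0 ?(ltnW m1) // /lam; ring.
have lam0 : 0 < lam.
  by rewrite lamE ltr_wpDr // ltr0n; lia.
have [a [f [la qf]]] := q_radius_eigen lam0 (le_trans lamN qNG).
have := q_eigen_le_edges (@adj_sym G) (@adj_irrefl G) G1 qf.
have n0 : 0 < (#|G| - 1)%:R :> R by rewrite ltr0n; lia.
move/(le_trans (_ : lam * (#|G| - 1)%:R <= _)); rewrite ler_pM2r // => /(_ la).
rewrite lamE -natrD; case: (posnP k) tk => [k0|k0] tk H.
  rewrite addn0 -(ler_nat R) natrM; apply: le_trans H.
  by rewrite ler_pM2r // lerDl.
rewrite addn1 -(ltr_nat R) natrM; apply: lt_le_trans H.
by rewrite ltr_pM2r // ltrDl tk.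
Qed.

(** * Traceability through the cone *)

Lemma leq_min_degree (G : sgraph) (k : nat) (x : G) :
  (k <= min_degree G)%N -> (k <= deg (@adj G) x)%N.
Proof.
move/leq_trans; apply; rewrite /min_degree.
elim: (index_enum G) (mem_index_enum x) => // y r IH; rewrite inE big_cons.
by case/orP => [/eqP<-|/IH xr]; rewrite geq_min ?leqnn // xr orbT.
Qed.

Definition cone (G : sgraph) : sgraph := join (complete 1) G.

Lemma cone_inl (G : sgraph) (i : 'I_1) : inl i = inl ord0 :> cone G.
Proof. by rewrite ord1. Qed.

(** The cycle, rotated to start at the apex, leaves a Hamilton path of [G] when the apex is
    deleted. *)
Lemma cone_hamiltonian (G : sgraph) :
  (0 < #|G|)%N -> ham (@adj (cone G)) -> traceable G.
Proof.
move=> G0 [c [_ cc uc cov]].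
have [i q Eq] := rot_to (cov (inl ord0)).
have uq : uniq (inl ord0 :: q) by rewrite -Eq rot_uniq.
have [p Ep] : exists p : seq G, q = map inr p.
  case/andP: uq => + _; elim: (q) => [|[j|x] r IH]; first by exists [::].
    by rewrite cone_inl mem_head.
  by rewrite inE negb_or => /= /IH[p ->]; exists (x :: p).
have covp y : y \in p.
  have := cov (inr y); rewrite -(mem_rot i) Eq inE /= Ep mem_map //.
  by move=> ? ? [].
move: cc; rewrite -(rot_cycle i) Eq Ep /= rcons_path => /andP[pp _].
case: p Ep covp pp => [|x p] Ep covp pp.
  by case/card_gt0P: G0 => x _; have := covp x.
exists x, p; split => //.
  by move: pp => /=; rewrite path_map.
by case/andP: uq => _; rewrite Ep; exact: (@map_uniq _ _ (@inr 'I_1 G) (x :: p)).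
Qed.

Lemma deg_cone_inr (G : sgraph) (x : G) :
  deg (@adj (cone G)) (inr x) = (deg (@adj G) x).+1.
Proof. by rewrite !degE big_sumType /= sum_nat_const card_ord. Qed.

Lemma deg_cone_inl (G : sgraph) (i : 'I_1) :
  deg (@adj (cone G)) (inl i) = #|G|.
Proof.
rewrite degE big_sumType /= big1 => [|j _]; last by rewrite /complete_rel !ord1.
by rewrite sum_nat_const muln1.
Qed.

Lemma sum_deg_cone (G : sgraph) :
  (\sum_x deg (@adj (cone G)) x = \sum_x deg (@adj G) x + 2 * #|G|)%N.
Proof.
rewrite big_sumType /= (eq_bigr _ (fun i _ => deg_cone_inl G i)).
rewrite (eq_bigr _ (fun x _ => deg_cone_inr x)) sum_nat_const card_ord.
under [X in (_ + X)%N]eq_bigr do rewrite -addn1.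
rewrite big_split /= sum1_card (_ : #|xpredT| = #|G|) //; lia.
Qed.

(** The apex is adjacent to everything: in [A] it would force all vertices into the too small set
    [A :|: X], so it lies in [X]. Deleting it lowers both [#|X|] and the parameter by one. *)
Lemma low_pair_cone (G : sgraph) (c k : nat) (A X : {set cone G}) :
  low_pair (@adj (cone G)) c k.+1 A X -> (0 < c)%N -> (c + k < #|G|)%N ->
  exists A' X' : {set G}, low_pair (@adj G) c k A' X'.
Proof.
move=> [dAX cA sk NA AA] c0 cG.
have uA : inl ord0 \notin A.
  apply/negP => uA.
  have : [set: cone G] \subset A :|: X.
    apply/fintype.subsetP => -[i|x] _; first by rewrite cone_inl inE uA.
    exact: (NA (inl ord0)).
  move/subset_leq_card; rewrite cardsT card_sum card_ord.
  have := cardsUI A X; lia.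
have /card_gt0P[a aA] : (0 < #|A|)%N by rewrite cA.
have uX : inl ord0 \in X.
  have := NA a (inl ord0) aA; rewrite inE (negbTE uA) /=; apply.
  by case: a aA => // i; rewrite cone_inl (negbTE uA).
have inr_inj : injective (@inr 'I_1 G) by move=> ? ? [].
pose A' := [set x : G | inr x \in A]; pose X' := [set x : G | inr x \in X].
have AE : A = [set inr x | x in A'].
  apply/setP => -[i|x].
    rewrite cone_inl (negbTE uA); apply/esym/negP => /imsetP[]//.
  by rewrite mem_imset // inE.
have XE : X = inl ord0 |: [set inr x | x in X'].
  apply/setP => -[i|x]; first by rewrite cone_inl uX !inE eqxx.
  by rewrite in_setU1 mem_imset // inE.
have cX : #|X| = #|X'|.+1.
  rewrite [in LHS]XE cardsU1 card_imset //.
  by case: imsetP => // -[].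
exists A', X'; split.
- rewrite -setI_eq0; apply/eqP/setP => x; rewrite !inE.
  by apply/negP => /andP[xA]; rewrite (disjointFr dAX xA).
- by rewrite -cA AE card_imset //; apply: eq_card => x; rewrite !inE mem_imset ?inE.
- by rewrite -ltnS -cX.
- by move=> b v; rewrite !inE => bA bv; have := NA (inr b) (inr v) bA bv; rewrite inE.
- move=> b; rewrite inE => bA; have := AA _ bA; rewrite cX subSS.
  apply: leq_trans; rewrite -(card_imset _ inr_inj).
  apply/subset_leq_card/fintype.subsetP => _ /imsetP[v + ->].
  by rewrite !inE.
Qed.

Theorem theorem1p8 (R : realType) (k n : nat) (G : sgraph) (hG : #|G| = n) :
  ((k <= min_degree G)%N ->
   (q_radius R (N_under_graph n k) <= q_radius R G)%R ->
   (maxn (6 * k + 10) ((3 * k ^ 2 + 9 * k + 8) %/ 2) <= n)%N ->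
   ~ isomorphic G (N_under_graph n k) -> traceable G)
  /\
  ((1 <= k)%N -> (k <= min_degree G)%N ->
   (q_radius R (N_graph n k) <= q_radius R G)%R ->
   (maxn (6 * k + 5) ((3 * k ^ 2 + 5 * k + 4) %/ 2) <= n)%N ->
   ~ isomorphic G (N_graph n k) -> hamiltonian G).
Proof.
(* The numerators are even by [even], so the integer division by 2 is exact. *)
have half a b : ~~ odd a -> (a %/ 2 <= b)%N -> (a <= 2 * b)%N by lia.
have even b c : odd b -> ~~ odd c -> ~~ odd (3 * k ^ 2 + b * k + c).
  by move=> ob ec; rewrite !oddD !oddM /= ob (negbTE ec); case: (odd k).
split.
- move=> dk qNG; rewrite geq_max => /andP[nk /(half _ _ (even 9%N 8%N isT isT)) nk2] niso.
  have m1 : (1 < n - 2 * k - 1)%N by lia.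
  have cG : #|G| = (n - 2 * k - 1 + k + k.+1)%N by lia.
  have G1 : (1 < #|G|)%N by lia.
  have edges := q_radius_edges m1 (ltn0Sn k) G1 qNG.
  apply: contrapT => ntr; apply: niso.
  have nh : ~ ham (@adj (cone G)).
    by move=> /cone_hamiltonian H; apply: ntr; apply: H; lia.
  have cC : #|cone G| = n.+1 by rewrite card_sum card_ord hG.
  have [||||A [X [lp _]]] := nonham_low_pair (k := k.+1) (@adj_sym (cone G))
    (@adj_irrefl (cone G)) nh.
  + by [].
  + by rewrite cC; lia.
  + case=> [i|x]; first by rewrite deg_cone_inl; lia.
    by rewrite deg_cone_inr ltnS leq_min_degree.
  + rewrite cC sum_deg_cone hG; move: edges; rewrite hG.
    set S := (\sum_x _)%N.
    have [m nm] : exists m, n = (k + k + m.+3)%N by exists (n - k - k - 3)%N; lia.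
    have -> : (n.+1 - k.+1 - 1 = k + m.+2)%N by lia.
    have -> : (n.+1 - k.+1 - 2 = k + m.+1)%N by lia.
    have -> : (n - 2 * k - 1 + k - 1 = k + m.+1)%N by lia.
    have -> : (n - 1 = k + k + m.+2)%N by lia.
    have -> : (n - 2 = k + k + m.+1)%N by lia.
    (* For [k > 0] the goal amounts to [3 * k ^ 2 + 9 * k + 8 < 2 * n + 1]; for [k = 0] it is
       [8 < 2 * n], which [10 <= n] gives. *)
    case: posnP => k0; move: nk nk2; rewrite -!mulnn nm ?k0; nia.
  have [||A' [X' lp']] := low_pair_cone lp; [by []|by lia|].
  exact: (isomorphic_N_gen m1 (ltn0Sn k) lp' cG qNG).
- move=> k0 dk qNG; rewrite geq_max => /andP[nk /(half _ _ (even 5%N 4%N isT isT)) nk2] niso.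
  have m1 : (1 < n - 2 * k)%N by lia.
  have cG : #|G| = (n - 2 * k + k + k)%N by lia.
  have G1 : (1 < #|G|)%N by lia.
  have edges := q_radius_edges m1 k0 G1 qNG.
  apply: contrapT => nh; apply: niso.
  have [|||A [X [lp _]]] := nonham_low_pair (@adj_sym G) (@adj_irrefl G) nh k0.
  + by rewrite hG; lia.
  + by move=> x; apply: leq_min_degree.
  + move: edges; rewrite hG k0; set S := (\sum_x _)%N.
    have [m nm] : exists m, n = (k + k + m.+2)%N by exists (n - k - k - 2)%N; lia.
    have -> : (n - k - 1 = k + m.+1)%N by lia.
    have -> : (n - k - 2 = k + m)%N by lia.
    have -> : (n - 2 * k + k - 1 = k + m.+1)%N by lia.
    have -> : (n - 1 = k + k + m.+1)%N by lia.
    have -> : (n - 2 = k + k + m)%N by lia.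
    (* The goal amounts to [3 * k ^ 2 + 5 * k + 4 < 2 * n + 1], the final 1 coming from the strict
       edge bound. *)
    move: nk2; rewrite -!mulnn nm; nia.
  exact: (isomorphic_N_gen m1 k0 lp cG qNG).
Qed.
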